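(* Let $G=(V,E)$ be a finite simple graph with maximum degree $\Delta$, and let $q$ be a positive integer with $q > 4\times 10^4\,\Delta^4$. Then for every probability distribution $\mathbf{p}=(p_1,\ldots,p_q)$ on the $q$ colors (that is, $p_i\ge 0$ and $p_1+\cdots+p_q=1$), $$P_G\left(\frac1q,\ldots,\frac1q\right)\ \ge\ P_G(p_1,\ldots,p_q).$$
   Context: For a finite simple graph $G=(V,E)$, a positive integer $q$ and a probability distribution $(p_1,\ldots,p_q)$ on the colors $\{1,\ldots,q\}$, color each vertex of $G$ independently at random, with color $i$ occurring with probability $p_i$. $P_G(p_1,\ldots,p_q)$ denotes the probability that the resulting coloring is proper, i.e. that no edge of $G$ has both endpoints of the same color. Equivalently, $P_G(p_1,\ldots,p_q)=\sum_{\alpha}\prod_{v\in V}p_{\alpha(v)}$, where the sum is over all maps $\alpha:V\to\{1,\ldots,q\}$ with $\alpha(u)\ne\alpha(v)$ for every edge $uv\in E$. *)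

(* Defs.v *)
From mathcomp Require Import all_boot all_order all_algebra.
From mathcomp Require Import reals.

Set Implicit Arguments.
Unset Strict Implicit.
Unset Printing Implicit Defensive.

Import Order.TTheory GRing.Theory Num.Theory.

Local Open Scope ring_scope.

Definition simple_graph (V : finType) (e : rel V) : Prop :=
  symmetric e /\ irreflexive e.

Definition degree (V : finType) (e : rel V) (v : V) : nat :=
  #|[set u | e v u]|.

Definition max_degree (V : finType) (e : rel V) : nat :=
  (\max_(v : V) degree e v)%N.

Definition proper_coloring (V : finType) (e : rel V) (q : nat)
    (alpha : {ffun V -> 'I_q}) : bool :=
  [forall u, forall v, e u v ==> (alpha u != alpha v)].

Definition distribution (R : realType) (q : nat) (p : 'I_q -> R) : Prop :=
  (forall i, 0 <= p i) /\ \sum_(i < q) p i = 1.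

Definition uniform (R : realType) (q : nat) : 'I_q -> R := fun=> q%:R^-1.
Arguments uniform : clear implicits.

(* Under independent coloring with law p, the coloring alpha occurs with
   probability \prod_v p (alpha v). *)
Definition proper_prob (R : realType) (V : finType) (e : rel V) (q : nat)
    (p : 'I_q -> R) : R :=
  \sum_(alpha : {ffun V -> 'I_q} | proper_coloring e alpha)
    \prod_(v : V) p (alpha v).

(* Main.v *)
(* Write P(p) for the probability of a proper colouring, D for the maximum
   degree, and eta = 1/(100 D).
   If some colour has p_a > eta, delete an edge uv: P(p) drops by a factor at
   most 1 - p_a^2 <= 1 - 2D/q (u and v may both receive a), whereas the uniform
   law loses at most the factor (1 - D/q)^2 >= 1 - 2D/q, so induction on the
   vertex set concludes.
   If all p_c <= eta, move mass from a colour a with p_a > 1/q to a colour b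
   with p_b < 1/q until one of them equals 1/q; finitely many moves reach the
   uniform law.  Along a move P is a polynomial in the moved mass, whose
   derivative is the sum over v of
     Pr[G - v proper, N(v) avoids b] - Pr[G - v proper, N(v) avoids a],
   and each term is nonnegative: exposing the neighbours of v one at a time
   gives a main term of order p_a - p_b and the same kind of difference on a
   smaller graph, damped by p_a <= eta, so that the recursion contracts. *)
Require Import Defs.
From mathcomp Require Import all_boot all_order all_algebra.
From mathcomp Require Import reals.
From mathcomp Require Import polyrcf ring lra zify.

Import Order.TTheory GRing.Theory Num.Theory.

Local Open Scope ring_scope.

Set Implicit Arguments.
Unset Strict Implicit.
Unset Printing Implicit Defensive.

(** * Product laws on colourings, and events that ignore the colour of one vertex *)

Section Weights.
Variables (V : finType) (q : nat).
Implicit Types (u v w : V) (c : 'I_q) (alpha : {ffun V -> 'I_q}).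

Definition recolor u c alpha : {ffun V -> 'I_q} :=
  [ffun v => if v == u then c else alpha v].

Definition free_at u (Q : pred {ffun V -> 'I_q}) : Prop :=
  forall c alpha, Q (recolor u c alpha) = Q alpha.

(** The weights live in any commutative ring because the same sum is later taken over polynomials,
    to be differentiated in the moved mass. *)
Definition pr (S : comNzRingType) (p : 'I_q -> S) (Q : pred {ffun V -> 'I_q}) : S :=
  \sum_(alpha | Q alpha) \prod_v p (alpha v).

Lemma recolor_at u c alpha : recolor u c alpha u = c.
Proof. by rewrite ffunE eqxx. Qed.

Lemma recolor_neq u c alpha v : v != u -> recolor u c alpha v = alpha v.
Proof. by rewrite ffunE => /negPf ->. Qed.

Section Ring.
Variables (S : comNzRingType) (p : 'I_q -> S).
Implicit Types Q E : pred {ffun V -> 'I_q}.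

Lemma eq_pr Q E : Q =1 E -> pr p Q = pr p E.
Proof. by move=> QE; apply: eq_bigl. Qed.

Lemma pr_split E Q :
  pr p Q = pr p [pred alpha | Q alpha && E alpha]
           + pr p [pred alpha | Q alpha && ~~ E alpha].
Proof. by rewrite /pr (bigID E). Qed.

Hypothesis p1 : \sum_c p c = 1.

Lemma pr_predT : pr p predT = 1.
Proof.
transitivity (\prod_(v : V) \sum_c p c); first by rewrite bigA_distr_bigA.
by rewrite big1.
Qed.

(** Recolouring [u] is a bijection between the colourings in [Q] with colour [c] at [u] and those
    with colour [d]; weighting by [p d] and summing over [d] restores the missing factor. Sums
    without the factor at [u] are what the Leibniz rule produces. *)
Lemma sum_color_at u c Q : free_at u Q ->
  \sum_(alpha | Q alpha && (alpha u == c)) \prod_(v | v != u) p (alpha v) = pr p Q.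
Proof.
move=> fQ; rewrite /pr [RHS](partition_big (fun alpha => alpha u) predT) //=.
rewrite -[LHS]mul1r -p1 mulr_suml; apply: eq_bigr => d _.
rewrite (reindex_onto (recolor u c) (recolor u d)) /=; last first.
  by move=> alpha /andP[_ /eqP <-]; apply/ffunP=> v; rewrite !ffunE; case: eqP => // ->.
rewrite mulr_sumr; apply: eq_big => [alpha|alpha].
  rewrite fQ recolor_at eqxx andbT; congr (_ && _).
  apply/eqP/eqP => [<-|<-]; first by rewrite recolor_at.
  by apply/ffunP=> v; rewrite !ffunE; case: eqP => // ->.
move=> /andP[_ /eqP]/ffunP/(_ u); rewrite recolor_at => ad.
rewrite [RHS](bigD1 u) //= -ad; congr (_ * _).
by apply: eq_bigr => v vu; rewrite recolor_neq.
Qed.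

Lemma pr_color_at u c Q : free_at u Q ->
  pr p [pred alpha | Q alpha && (alpha u == c)] = p c * pr p Q.
Proof.
move=> fQ; rewrite -(sum_color_at c fQ) /pr mulr_sumr /=.
by apply: eq_bigr => alpha /andP[_ /eqP <-]; rewrite (bigD1 u).
Qed.

End Ring.

Section Real.
Variables (R : realType) (p : 'I_q -> R).
Implicit Types Q E : pred {ffun V -> 'I_q}.
Hypothesis p0 : forall c, 0 <= p c.

Lemma pr_ge0 Q : 0 <= pr p Q.
Proof. by apply: sumr_ge0 => alpha _; apply: prodr_ge0. Qed.

Lemma le_pr Q E : (forall alpha, Q alpha -> E alpha) -> pr p Q <= pr p E.
Proof.
move=> QE; rewrite (pr_split p Q E) -[leLHS]addr0 lerD ?pr_ge0 //.
rewrite (@eq_pr _ p Q [pred alpha | E alpha && Q alpha]) // => alpha /=.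
by case Qa: (Q alpha); rewrite ?andbF // QE.
Qed.

Lemma pr_union (I : finType) (A : {set I}) Q (B : I -> pred {ffun V -> 'I_q}) :
  pr p [pred alpha | Q alpha && [exists i in A, B i alpha]]
  <= \sum_(i in A) pr p [pred alpha | Q alpha && B i alpha].
Proof.
rewrite /pr /=.
under [leRHS]eq_bigr => i _ do rewrite big_mkcondr /=.
rewrite exchange_big /= big_mkcondr /=; apply: ler_sum => alpha _.
have pr0 : 0 <= \prod_v p (alpha v) by apply: prodr_ge0.
have ge0 P : 0 <= if P then \prod_v p (alpha v) else 0 by case: P.
case: ifP => [/existsP[i /andP[iA Bi]]|_]; last by apply: sumr_ge0.
by rewrite (bigD1 i) //= Bi lerDl; apply: sumr_ge0.
Qed.

Variable eta : R.
Hypothesis p1 : \sum_c p c = 1.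
Hypothesis p_le : forall c, p c <= eta.

Lemma pr_color_at_le u c Q : free_at u Q ->
  pr p [pred alpha | Q alpha && (alpha u == c)] <= eta * pr p Q.
Proof. by move=> fQ; rewrite pr_color_at // ler_wpM2r ?pr_ge0. Qed.

Lemma pr_color_in_le u (F : {set 'I_q}) Q : free_at u Q ->
  pr p [pred alpha | Q alpha && (alpha u \in F)] <= #|F|%:R * eta * pr p Q.
Proof.
move=> fQ.
apply: le_trans (_ : _ <= pr p [pred alpha | Q alpha && [exists c in F, alpha u == c]]) _.
  apply: le_pr => alpha /= /andP[-> aF] /=.
  by apply/existsP; exists (alpha u); rewrite aF eqxx.
apply: le_trans (pr_union _ _ _) _.
rewrite -mulrA mulr_natl -sumr_const; apply: ler_sum => c _.
exact: pr_color_at_le.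
Qed.

(** Once the colour of [w] is fixed, [u] is still independent of the event and hits that colour with
    probability at most [eta]. *)
Lemma pr_same_color_le u w Q : free_at u Q -> w != u ->
  pr p [pred alpha | Q alpha && (alpha u == alpha w)] <= eta * pr p Q.
Proof.
move=> fQ wu; rewrite {2}/pr (partition_big (fun alpha => alpha w) predT) //=.
rewrite {1}/pr (partition_big (fun alpha => alpha w) predT) //= mulr_sumr.
apply: ler_sum => c _.
apply: le_trans (pr_color_at_le (u := u) c (Q := [pred alpha | Q alpha && (alpha w == c)]) _).
  by apply: le_pr => alpha /= /andP[/andP[-> /eqP ->] ->].
by move=> d alpha /=; rewrite fQ recolor_neq.
Qed.

(** Union bound: every forbidden colour in [F] and every vertex of [N] spoils the colour of [u] with
    conditional probability at most [eta]. *)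
Lemma pr_extend u (N : {set V}) (F : {set 'I_q}) Q : free_at u Q -> u \notin N ->
  (1 - (#|N| + #|F|)%:R * eta) * pr p Q <=
  pr p [pred alpha | Q alpha && ((alpha u \notin F) && [forall w in N, alpha u != alpha w])].
Proof.
move=> fQ uN.
pose ok alpha := (alpha u \notin F) && [forall w in N, alpha u != alpha w].
pose Q1 := [pred alpha | Q alpha && ~~ ok alpha].
suff: pr p Q1 <= (#|N| + #|F|)%:R * eta * pr p Q.
  by have := pr_split p ok Q; rewrite -/Q1 -/ok; lra.
rewrite natrD mulrDl mulrDl addrC (pr_split p (fun alpha => alpha u \in F) Q1) lerD //.
  apply: le_trans (pr_color_in_le F fQ).
  by apply: le_pr => alpha /= /andP[/andP[-> _] ->].
apply: le_trans (_ : _ <= pr p [pred alpha | Q alpha && [exists w in N, alpha u == alpha w]]) _.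
  apply: le_pr => alpha; rewrite /= /ok => /andP[/andP[-> +] uF]; rewrite uF /=.
  rewrite negb_forall => /existsP[w]; rewrite negb_imply negbK => H.
  by apply/existsP; exists w.
apply: le_trans (pr_union _ _ _) _.
rewrite -mulrA mulr_natl -sumr_const; apply: ler_sum => w wN.
by apply: pr_same_color_le => //; apply: contraNneq uN => <-.
Qed.

End Real.

End Weights.

(** * Proper colourings of induced subgraphs with two colours to avoid *)

Section Graph.
Variables (V : finType) (e : rel V) (q : nat).
Hypotheses (e_sym : symmetric e) (e_irr : irreflexive e).
Implicit Types (u v w : V) (U X Y : {set V}) (a b c : 'I_q).
Implicit Types alpha beta : {ffun V -> 'I_q}.

Definition nbh u : {set V} := [set w | e u w].

Definition proper_on U alpha :=
  [forall u in U, forall v in U, e u v ==> (alpha u != alpha v)].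

Definition avoids c X alpha := [forall v in X, alpha v != c].

(* Deleted vertices (those outside U) keep an unconstrained colour, so that
   every subgraph lives on the same probability space. *)
Definition constrained a b U X Y alpha :=
  [&& proper_on U alpha, avoids a (U :&: X) alpha & avoids b (U :&: Y) alpha].

Lemma proper_onP U alpha :
  reflect (forall u v, u \in U -> v \in U -> e u v -> alpha u != alpha v)
          (proper_on U alpha).
Proof.
apply: (iffP forallP) => [H u v uU vU euv|H u].
  by move: (H u); rewrite uU => /forallP/(_ v); rewrite vU euv.
by apply/implyP => uU; apply/forallP => v; apply/implyP => vU; apply/implyP; apply: H.
Qed.

Lemma avoidsP c X alpha :
  reflect (forall v, v \in X -> alpha v != c) (avoids c X alpha).
Proof. exact: forall_inP. Qed.

Lemma eq_proper_on U alpha beta :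
  {in U, alpha =1 beta} -> proper_on U alpha = proper_on U beta.
Proof.
by move=> ab; apply/proper_onP/proper_onP => H u v uU vU /(H u v uU vU); rewrite !ab.
Qed.

Lemma eq_avoids c X alpha beta :
  {in X, alpha =1 beta} -> avoids c X alpha = avoids c X beta.
Proof. by move=> ab; apply/avoidsP/avoidsP => H v vX; move: (H v vX); rewrite !ab. Qed.

Lemma recolor_in u U c alpha : u \notin U -> {in U, recolor u c alpha =1 alpha}.
Proof. by move=> uU v vU; rewrite recolor_neq //; apply: contraNneq uU => <-. Qed.

Lemma free_proper_on u U : u \notin U -> free_at u (proper_on U).
Proof. by move=> uU c alpha; apply/eq_proper_on/recolor_in. Qed.

Lemma free_constrained a b u U X Y : u \notin U -> free_at u (constrained a b U X Y).
Proof.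
move=> uU c alpha; rewrite /constrained (free_proper_on uU).
by congr [&& _, _ & _]; apply: eq_avoids => v /setIP[/(recolor_in c alpha uU)].
Qed.

Lemma proper_onD1 u U alpha : u \in U ->
  proper_on U alpha
  = proper_on (U :\ u) alpha && [forall w in nbh u :&: (U :\ u), alpha u != alpha w].
Proof.
move=> uU; apply/proper_onP/andP => [H|[/proper_onP H1 /forall_inP H2] v w vU wU evw].
  split; first by apply/proper_onP => v w /setD1P[_ vU] /setD1P[_ wU]; apply: H.
  apply/forall_inP => w; rewrite !inE => /and3P[euw _ wU]; exact: H.
have [vu|vu] := eqVneq v u.
  subst v; apply: H2; rewrite !inE evw wU andbT /=.
  by apply: contraTneq evw => ->; rewrite e_irr.
have [wu|wu] := eqVneq w u; last by apply: H1; rewrite // !inE ?vu ?wu.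
by subst w; rewrite eq_sym; apply: H2; rewrite !inE e_sym evw vu vU.
Qed.

Lemma avoidsD1 c u U X alpha : u \in U ->
  avoids c (U :&: X) alpha
  = avoids c ((U :\ u) :&: X) alpha && ((u \in X) ==> (alpha u != c)).
Proof.
move=> uU; apply/avoidsP/andP => [H|[/avoidsP H1 /implyP H2] v].
  split; last by apply/implyP => uX; apply: H; rewrite inE uU.
  by apply/avoidsP => v; rewrite !inE => /andP[/andP[_ vU] vX]; apply: H; rewrite inE vU.
rewrite inE => /andP[vU vX]; have [vu|vu] := eqVneq v u.
  by subst v; apply: H2.
by apply: H1; rewrite !inE vu vU.
Qed.

Lemma constrainedD1 a b u U X Y alpha : u \in U ->
  constrained a b U X Y alpha =
  constrained a b (U :\ u) X Y alpha &&
  [&& [forall w in nbh u :&: (U :\ u), alpha u != alpha w],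
      (u \in X) ==> (alpha u != a) & (u \in Y) ==> (alpha u != b)].
Proof.
move=> uU; rewrite /constrained (proper_onD1 _ uU) !(avoidsD1 _ _ _ uU).
by rewrite -!andbA; do ![bool_congr].
Qed.

Lemma constrained_swap a b U X Y alpha :
  constrained a b U X Y alpha = constrained b a U Y X alpha.
Proof. by rewrite /constrained andbA andbAC -andbA. Qed.

Lemma constrainedW a b U U' X X' Y Y' alpha :
    U' \subset U -> U' :&: X' \subset X -> U' :&: Y' \subset Y ->
  constrained a b U X Y alpha -> constrained a b U' X' Y' alpha.
Proof.
move=> /subsetP sU /subsetP sX /subsetP sY /and3P[/proper_onP H1 /avoidsP H2 /avoidsP H3].
apply/and3P; split.
- by apply/proper_onP => u v /sU uU /sU vU; apply: H1.
- by apply/avoidsP => v vX; apply: H2; rewrite inE (sX _ vX); case/setIP: vX => /sU ->.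
- by apply/avoidsP => v vY; apply: H3; rewrite inE (sY _ vY); case/setIP: vY => /sU ->.
Qed.

Section Weight.
Variables (R : realType) (p : 'I_q -> R) (Dl : nat) (eta : R).
Hypotheses (p0 : forall c, 0 <= p c) (p1 : \sum_c p c = 1).
Hypothesis p_le : forall c, p c <= eta.
Hypothesis deg_le : forall u, (#|nbh u| <= Dl)%N.

Definition wt a b U X Y := pr p (constrained a b U X Y).

Lemma wt_swap a b U X Y : wt a b U X Y = wt b a U Y X.
Proof. by apply: eq_pr => alpha; apply: constrained_swap. Qed.

Lemma wt_ge0 a b U X Y : 0 <= wt a b U X Y.
Proof. exact: pr_ge0. Qed.

Lemma le_wt a b U U' X X' Y Y' :
  U' \subset U -> U' :&: X' \subset X -> U' :&: Y' \subset Y ->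
  wt a b U X Y <= wt a b U' X' Y'.
Proof. by move=> sU sX sY; apply: le_pr => // alpha; apply: constrainedW. Qed.

Lemma eta_ge0 c : 0 <= eta.
Proof. exact: le_trans (p0 c) (p_le c). Qed.

Lemma wt_extend a b u U X Y : u \in U ->
  (1 - (Dl + 2)%:R * eta) * wt a b (U :\ u) X Y <= wt a b U (u |: X) (u |: Y).
Proof.
move=> uU; have fQ : free_at u (constrained a b (U :\ u) X Y).
  by apply: free_constrained; rewrite !inE eqxx.
have uN : u \notin nbh u :&: (U :\ u) by rewrite !inE e_irr.
apply: le_trans (le_trans (pr_extend p0 p1 p_le [set a; b] fQ uN) _).
  apply: ler_wpM2r; first exact: pr_ge0.
  rewrite lerD2l lerN2 ler_wpM2r ?(eta_ge0 a) // ler_nat leq_add //.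
    by apply: leq_trans (deg_le u); apply: subset_leq_card; apply: subsetIl.
  by rewrite cards2; case: (a != b).
apply: le_pr => // alpha /= /and3P[H + H2]; rewrite !inE negb_or => /andP[aa ab].
rewrite (constrainedD1 _ _ _ _ _ uU) H2 aa ab !implybT /= andbT.
by apply: constrainedW H => //; apply/subsetP => v; rewrite !inE => /andP[/andP[/negPf -> _]].
Qed.

(** Split on whether [u] has colour [b]. If not, [u] joins [Y]. If so, [u] meets its constraint from
    [X] because [a != b], and it can be deleted at the price of making its neighbours avoid [b]. *)
Lemma wt_rec a b u U X Y : a != b -> u \in U -> u \in X -> u \notin Y ->
  wt a b U X Y = wt a b U X (u |: Y) + p b * wt a b (U :\ u) X (Y :|: nbh u).
Proof.
move=> ab uU uX uY; rewrite {1}/wt (pr_split p (fun alpha => alpha u == b)) addrC.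
congr (_ + _).
  apply: eq_pr => alpha /=; rewrite !(constrainedD1 _ _ _ _ _ uU) uX (negPf uY) !inE eqxx /=.
  have -> : constrained a b (U :\ u) X (u |: Y) alpha = constrained a b (U :\ u) X Y alpha.
    rewrite /constrained; congr [&& _, _ & avoids _ _ _].
    by apply/setP => v; rewrite !inE; case: (eqVneq v u).
  by rewrite -!andbA.
have fQ : free_at u (constrained a b (U :\ u) X (Y :|: nbh u)).
  by apply: free_constrained; rewrite !inE eqxx.
rewrite -(pr_color_at p1 _ fQ); apply: eq_pr => alpha /=.
case: eqP => [au|]; rewrite ?andbF // !andbT.
rewrite (constrainedD1 _ _ _ _ _ uU) uX (negPf uY) /= au eq_sym ab /= !andbT.
rewrite /constrained -!andbA; do 2![congr (_ && _)].
apply/andP/avoidsP => [[/avoidsP H1 /forall_inP H2] v|H].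
  rewrite !inE => /andP[vU /orP[vY|vN]]; first by apply: H1; rewrite !inE vU.
  by rewrite eq_sym; apply: H2; rewrite !inE vN vU.
split; first by apply/avoidsP => v; rewrite !inE => /andP[vU vY]; apply: H; rewrite !inE vU vY.
by apply/forall_inP => v; rewrite !inE => /andP[vN vU];
  rewrite eq_sym; apply: H; rewrite !inE vU vN orbT.
Qed.

Definition symdiff X Y := (X :\: Y) :|: (Y :\: X).

(** A colouring that meets the common constraints but not all of them has colour [a] or [b] at an
    asymmetric vertex. For each such vertex, deleting it costs a factor [lam], and the two colours
    together have mass at most [2 * eta]. *)
Lemma wt_relax a b U X Y (lam : R) :
    (forall u, u \in U -> wt a b (U :\ u) (X :&: Y) (X :&: Y)
                          <= lam * wt a b U (X :&: Y) (X :&: Y)) ->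
  (1 - #|U :&: symdiff X Y|%:R * (2 * eta * lam)) * wt a b U (X :&: Y) (X :&: Y)
  <= wt a b U X Y.
Proof.
set W := X :&: Y => lamP; rewrite mulrBl mul1r lerBlDr {1}/wt.
rewrite (pr_split p (constrained a b U X Y)) lerD //.
  by apply: le_pr => // alpha /= /andP[].
apply: le_trans (_ : _ <= pr p [pred alpha | constrained a b U W W alpha &&
    [exists u in U :&: symdiff X Y, alpha u \in [set a; b]]]) _.
  apply: le_pr => // alpha /= /andP[H]; rewrite H /=; apply: contraR.
  rewrite negb_exists => /forallP nH; case/and3P: H => H1 /avoidsP H2 /avoidsP H3.
  apply/and3P; split=> //; apply/avoidsP => v /setIP[vU vX].
    case vY: (v \in Y); first by apply: H2; rewrite !inE vU vX.
    by move: (nH v); rewrite !inE vU vX vY /= negb_or => /andP[].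
  case vX': (v \in X); first by apply: H3; rewrite !inE vU vX vX'.
  by move: (nH v); rewrite !inE vU vX vX' /= negb_or => /andP[].
apply: le_trans (pr_union _ _ _ _) _ => //.
rewrite -[leRHS]mulrA [leRHS]mulr_natl -sumr_const; apply: ler_sum => u /setIP[uU _].
have fQ : free_at u (constrained a b (U :\ u) W W).
  by apply: free_constrained; rewrite !inE eqxx.
apply: le_trans (_ : _ <= pr p [pred alpha | constrained a b (U :\ u) W W alpha &&
    (alpha u \in [set a; b])]) _.
  apply: le_pr => // alpha /= /andP[H ->]; rewrite andbT.
  by apply: constrainedW H; rewrite ?subsetIr // subD1set.
apply: le_trans (pr_color_in_le p0 p1 p_le _ fQ) _.
rewrite -[leRHS]mulrA ler_pM ?mulr_ge0 ?wt_ge0 ?(eta_ge0 a) ?lamP //.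
by rewrite ler_wpM2r ?(eta_ge0 a) // ler_nat cards2; case: (a != b).
Qed.

(** * The bias between two colours: its recursion, size and sign *)

Hypothesis Dl_gt0 : (0 < Dl)%N.
Hypothesis eta_Dl : 100 * Dl%:R * eta = 1.

(* A supersolution of the recursion that bias_rec imposes on a bound in terms
   of the number s of asymmetric constraints; since (1 + 1/(2 Dl))^Dl <= 2, the
   jump from s to s + Dl costs only a constant factor. *)
Definition kap s : R := 4 * Dl%:R * ((1 + (2 * Dl%:R)^-1) ^+ s - 1).

Lemma Dl_ge1 : 1 <= Dl%:R :> R.
Proof. by rewrite ler1n. Qed.

Lemma growth_ge1 s : 1 <= (1 + (2 * Dl%:R)^-1) ^+ s :> R.
Proof. by apply: exprn_ege1; rewrite lerDl invr_ge0; have := Dl_ge1; lra. Qed.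

(** With t = 1/(2 Dl), Bernoulli gives (1 - t)^Dl >= 1/2, and (1 - t)(1 + t) <= 1. *)
Lemma growth_Dl : (1 + (2 * Dl%:R)^-1) ^+ Dl <= 2 :> R.
Proof.
set t := (2 * Dl%:R)^-1; have D1 := Dl_ge1.
have tD : t * Dl%:R = 2^-1 by rewrite /t; field; lra.
have t0 : 0 < t by rewrite /t invr_gt0; lra.
have t1 : t <= 2^-1 by nra.
have bern n : 1 - t * n%:R <= (1 - t) ^+ n.
  elim: n => [|n IHn]; first by rewrite expr0; lra.
  rewrite exprS -natr1; have : 0 <= n%:R :> R by []; nra.
have : (1 - t) ^+ Dl * (1 + t) ^+ Dl <= 1.
  by rewrite -exprMn exprn_ile1 //; nra.
by have := bern Dl; have := growth_ge1 Dl; rewrite -/t tD; nra.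
Qed.

Lemma kap_ge0 s : 0 <= kap s.
Proof. by rewrite /kap; have := Dl_ge1; have := growth_ge1 s; nra. Qed.

Lemma eta_gt0 : 0 < eta.
Proof. by have := Dl_ge1; have := eta_Dl; nra. Qed.

(** The terms on the left match those of [bias_rec], with 11/10 the price of deleting a vertex from
    [wt_delete]. Writing g for the s-th power in [kap s], the right side exceeds [kap s] by 2g,
    while the other two terms are at most 11/10 + 44/1000 (2g - 1), and g >= 1. *)
Lemma kap_step s : kap s + 11/10 + eta * (11/10) * kap (s + Dl) <= kap s.+1.
Proof.
rewrite /kap exprD exprS; have := growth_Dl; have := growth_ge1 s; have := growth_ge1 Dl.
have : (2 * Dl%:R)^-1 * Dl%:R = 2^-1 :> R by have := Dl_ge1 => D1; field; lra.
set t := (2 * Dl%:R)^-1; set g := _ ^+ s; set h := _ ^+ Dl => tD h1 g1 h2.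
have -> : eta * (11/10) * (4 * Dl%:R * (g * h - 1)) =
  (100 * Dl%:R * eta) * (44/1000 * (g * h - 1)) by field.
have -> : 4 * Dl%:R * ((1 + t) * g - 1) = 4 * Dl%:R * (g - 1) + 4 * (t * Dl%:R) * g by ring.
by rewrite eta_Dl tD; nra.
Qed.

(** Twice [Dl] bounds the asymmetry left after one exposure in [bias_le0]. The power in [kap] is
    then at most 4, which gives 4/100 times 3. *)
Lemma kap_double : eta * kap (Dl + Dl) <= 12/100.
Proof.
rewrite /kap exprD; have := growth_Dl; have := growth_ge1 Dl; set h := _ ^+ Dl => h1 h2.
have -> : eta * (4 * Dl%:R * (h * h - 1)) =
  (100 * Dl%:R * eta) * (4/100 * (h * h - 1)) by field.
by rewrite eta_Dl; nra.
Qed.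

(** By [wt_extend], restoring [u] keeps at least the fraction 1 - (Dl + 2) eta >= 97/100, and 100/97
    < 11/10. *)
Lemma wt_delete a b u U X Y : u \in U -> wt a b (U :\ u) X Y <= 11/10 * wt a b U X Y.
Proof.
move=> uU; have := wt_extend a b X Y uU.
have : wt a b U (u |: X) (u |: Y) <= wt a b U X Y.
  by apply: le_wt => //; apply/subsetP => v; rewrite !inE => /andP[_ ->]; rewrite orbT.
have z0 := wt_ge0 a b (U :\ u) X Y; have D1 := Dl_ge1; have e0 := eta_gt0.
have -> : (Dl + 2)%:R * eta = 1/100 + 2 * eta by rewrite natrD; have := eta_Dl; lra.
have e1 : eta <= 1/100 by have := eta_Dl; nra.
have : eta * wt a b (U :\ u) X Y <= 1/100 * wt a b (U :\ u) X Y by rewrite ler_wpM2r.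
lra.
Qed.

(** Its sign decides the comparison: by [deriv_transfer], the derivative along a move of mass is
    minus a sum of biases with [X] a neighbourhood and [Y] empty. *)
Definition bias a b U X Y := wt a b U X Y - wt b a U X Y.

Lemma bias_swap a b U X Y : bias a b U X Y = - bias a b U Y X.
Proof. by rewrite /bias opprB (wt_swap a b U X) (wt_swap b a U X). Qed.

(* Condition on whether u has colour b, respectively a. *)
Lemma bias_rec a b u U X Y : a != b -> u \in U -> u \in X -> u \notin Y ->
  bias a b U X Y = bias a b U X (u |: Y)
    - (p a - p b) * wt a b (U :\ u) X (Y :|: nbh u)
    + p a * bias a b (U :\ u) X (Y :|: nbh u).
Proof.
move=> ab uU uX uY; rewrite /bias (wt_rec ab uU uX uY).
by rewrite eq_sym in ab; rewrite (wt_rec ab uU uX uY); ring.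
Qed.

Lemma symdiffC X Y : symdiff X Y = symdiff Y X.
Proof. by rewrite /symdiff setUC. Qed.

Lemma card_symdiff_add u U X Y s : u \in U -> u \in X -> u \notin Y ->
  (#|U :&: symdiff X Y| <= s.+1)%N -> (#|U :&: symdiff X (u |: Y)| <= s)%N.
Proof.
move=> uU uX uY; rewrite (cardsD1 u) !inE uU uX uY /= add1n ltnS; apply: leq_trans.
apply: subset_leq_card; apply/subsetP => v; rewrite !inE.
by case: (eqVneq v u) => [->|_] //=; rewrite uX !andbF.
Qed.

Lemma card_symdiff_nbh u U X Y s : u \in U -> u \in X -> u \notin Y ->
  (#|U :&: symdiff X Y| <= s.+1)%N ->
  (#|(U :\ u) :&: symdiff X (Y :|: nbh u)| <= s + Dl)%N.
Proof.
move=> uU uX uY; rewrite (cardsD1 u) !inE uU uX uY /= add1n ltnS => H.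
apply: leq_trans (leq_add H (deg_le u)).
apply: leq_trans (leq_card_setU _ _); apply: subset_leq_card; apply/subsetP => v.
rewrite !inE; case: (v == u) => //=.
by case: (v \in U); case: (v \in X); case: (v \in Y); case: (e u v).
Qed.

(** Double induction, on the size of [U] and then on [s]. In [bias_rec] the first bias has one
    asymmetric vertex fewer; the last may have [Dl] more, but lives on a smaller vertex set and
    carries the factor [p a <= eta], so [kap_step] closes the recursion. *)
Lemma bias_bound a b U X Y s : a != b -> p b <= p a ->
    (#|U :&: symdiff X Y| <= s)%N ->
  `|bias a b U X Y| <= (p a - p b) * kap s * wt a b U (X :&: Y) (X :&: Y).
Proof.
move=> ab pab; move: {2}#|U| (leqnn #|U|) => n; elim: n U X Y s => [|n IHn] U X Y s.
  rewrite leqn0 cards_eq0 => /eqP -> _; rewrite /bias (_ : wt a b set0 X Y = wt b a set0 X Y).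
    by rewrite subrr normr0; apply: mulr_ge0 (wt_ge0 _ _ _ _ _);
      apply: mulr_ge0 (kap_ge0 _); rewrite subr_ge0.
  by apply: eq_pr => alpha; rewrite /constrained !set0I; congr (_ && _); rewrite andbC.
move=> cU; elim: s X Y => [|s IHs] X Y cs.
  move: cs; rewrite leqn0 cards_eq0 => /eqP sd0.
  rewrite /bias (_ : wt a b U X Y = wt b a U X Y).
    by rewrite subrr normr0; apply: mulr_ge0 (wt_ge0 _ _ _ _ _);
      apply: mulr_ge0 (kap_ge0 _); rewrite subr_ge0.
  rewrite wt_swap; apply/eqP; rewrite eq_le; apply/andP; split; apply: le_wt => //;
  apply/subsetP => v; move/setP/(_ v): sd0; rewrite !inE;
  by case: (v \in U); case: (v \in X); case: (v \in Y).
have [sd0|[u]] := set_0Vmem (U :&: symdiff X Y).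
  have := IHs X Y; rewrite sd0 cards0 => /(_ isT)/le_trans; apply.
  apply: ler_wpM2r; first exact: wt_ge0.
  apply: ler_wpM2l; first by rewrite subr_ge0.
  have /(mulr_ge0 (ltW eta_gt0)) := kap_ge0 (s + Dl); have := kap_step s; lra.
(* Exchanging [X] and [Y] only changes the sign of the bias. *)
wlog uX : X Y cs / u \in X.
  move=> H uI; case uX: (u \in X); first exact: H.
  have uY : u \in Y by move: uI; rewrite !inE uX andbF => /andP[].
  by rewrite bias_swap normrN setIC; apply: H => //; rewrite symdiffC.
rewrite !inE uX => /andP[uU]; rewrite andbT /= orbF => uY.
rewrite (bias_rec ab uU uX uY).
have H1 := IHs _ _ (card_symdiff_add uU uX uY cs).
have cU' : (#|U :\ u| <= n)%N by move: cU; rewrite (cardsD1 u) uU add1n ltnS.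
have H2 := IHn _ _ _ _ cU' (card_symdiff_nbh uU uX uY cs).
set W := X :&: Y.
have Zdel : wt a b (U :\ u) W W <= 11/10 * wt a b U W W := wt_delete a b W W uU.
have Z1 : wt a b U (X :&: (u |: Y)) (X :&: (u |: Y)) <= wt a b U W W.
  by apply: le_wt => //; apply/subsetP => v; rewrite !inE => /andP[_ /andP[vX vY]];
    rewrite ?vX ?vY ?orbT.
have Z2 : wt a b (U :\ u) X (Y :|: nbh u) <= wt a b (U :\ u) W W.
  by apply: le_wt => //; apply/subsetP => v; rewrite !inE => /andP[_ /andP[vX vY]];
    rewrite ?vX ?vY ?orbT.
have Z3 : wt a b (U :\ u) (X :&: (Y :|: nbh u)) (X :&: (Y :|: nbh u)) <= wt a b (U :\ u) W W.
  by apply: le_wt => //; apply/subsetP => v; rewrite !inE => /andP[_ /andP[vX vY]];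
    rewrite ?vX ?vY ?orbT.
have Kstep := kap_step s; have K1 := kap_ge0 s; have K2 := kap_ge0 (s + Dl).
have zW := wt_ge0 a b U W W; have z2 := wt_ge0 a b (U :\ u) X (Y :|: nbh u).
have dp : 0 <= p a - p b by rewrite subr_ge0.
have B1 : `|bias a b U X (u |: Y)| <= (p a - p b) * (kap s * wt a b U W W).
  by apply: le_trans H1 _; rewrite -mulrA ler_wpM2l // ler_wpM2l.
have B2 : `|(p a - p b) * wt a b (U :\ u) X (Y :|: nbh u)|
          <= (p a - p b) * (11/10 * wt a b U W W).
  rewrite normrM ger0_norm // ler_wpM2l // ger0_norm //; exact: le_trans Zdel.
have B3 : `|p a * bias a b (U :\ u) X (Y :|: nbh u)|
          <= (p a - p b) * (eta * (11/10) * kap (s + Dl) * wt a b U W W).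
  rewrite normrM ger0_norm //.
  apply: le_trans (ler_pM _ _ (p_le a) H2) _ => //.
  have -> : (p a - p b) * (eta * (11/10) * kap (s + Dl) * wt a b U W W)
      = eta * ((p a - p b) * kap (s + Dl) * (11/10 * wt a b U W W)) by ring.
  rewrite ler_wpM2l ?(ltW eta_gt0) // ler_wpM2l ?(mulr_ge0 dp K2) //; exact: le_trans Zdel.
apply: le_trans (ler_normD _ _) _; apply: le_trans (lerD (ler_normB _ _) (lexx _)) _.
apply: le_trans (lerD (lerD B1 B2) B3) _.
rewrite [leLHS](_ : _ = (p a - p b) *
  ((kap s + 11/10 + eta * (11/10) * kap (s + Dl)) * wt a b U W W)); last by ring.
by rewrite -[leRHS]mulrA; apply: ler_wpM2l => //; apply: ler_wpM2r.
Qed.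

(** Induction on the asymmetry: exposing [u] in [X] but not in [Y] leaves a first bias that is
    nonpositive by induction. The main term is at least 9/10 of [(p a - p b) * zW], and the damped
    bias at most 12/100 of it. *)
Lemma bias_le0 a b U X Y : a != b -> p b <= p a -> Y \subset X -> (#|X| <= Dl)%N ->
  bias a b U X Y <= 0.
Proof.
move=> ab pab; move: {2}#|U :&: symdiff X Y| (leqnn #|U :&: symdiff X Y|) => s.
elim: s Y => [|s IHs] Y cs sYX cX.
  have := bias_bound ab pab cs; rewrite {1}/kap expr0 subrr !mulr0 mul0r normr_le0.
  by move/eqP ->.
have [sd0|[u]] := set_0Vmem (U :&: symdiff X Y).
  by apply: IHs => //; rewrite sd0 cards0.
rewrite !inE => /andP[uU]; case uX: (u \in X); last first.
  by rewrite andbF /= => /(subsetP sYX); rewrite uX.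
rewrite andbT /= orbF => uY; rewrite (bias_rec ab uU uX uY).
have H1 : bias a b U X (u |: Y) <= 0.
  apply: IHs => //; first exact: card_symdiff_add.
  by rewrite subUset sub1set uX.
set Y' := Y :|: nbh u.
(* Since [Y] lies in [X], every asymmetric vertex lies in [X] or is a neighbour of [u]. *)
have c2 : (#|(U :\ u) :&: symdiff X Y'| <= Dl + Dl)%N.
  apply: leq_trans (leq_add cX (deg_le u)); apply: leq_trans (leq_card_setU _ _).
  apply: subset_leq_card; apply/subsetP => v; rewrite !inE.
  move/subsetP/(_ v): sYX.
  by case: (v \in X); case: (v \in Y) => //=; case: (e u v); rewrite ?andbF // => /(_ isT).
have H2 := bias_bound ab pab c2.
have H3 := @wt_relax a b (U :\ u) X Y' (11/10) (fun v vU => wt_delete a b _ _ vU).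
move: H2 H3; set zW := wt a b _ (_ :&: _) _ => H2 H3.
have zW0 : 0 <= zW by apply: wt_ge0.
have cR : #|(U :\ u) :&: symdiff X Y'|%:R <= Dl%:R + Dl%:R :> R by rewrite -natrD ler_nat.
(* The loss in [wt_relax] is at most 2 Dl times 2 eta times 11/10, which is 44/1000. *)
have z1 : 9/10 * zW <= wt a b (U :\ u) X Y'.
  apply: le_trans H3; rewrite ler_wpM2r //.
  have := eta_gt0; have := eta_Dl; move: cR; set c := #|_|%:R; nra.
have H4 : p a * bias a b (U :\ u) X Y' <= (p a - p b) * (12/100 * zW).
  apply: le_trans (ler_norm _) _; rewrite normrM ger0_norm //.
  apply: le_trans (ler_pM _ _ (p_le a) H2) _ => //.
  have -> : eta * ((p a - p b) * kap (Dl + Dl) * zW)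
      = (p a - p b) * (eta * kap (Dl + Dl) * zW) by ring.
  by rewrite ler_wpM2l ?subr_ge0 // ler_wpM2r // kap_double.
have : (p a - p b) * (12/100 * zW) <= (p a - p b) * wt a b (U :\ u) X Y'.
  by rewrite ler_wpM2l ?subr_ge0 //; apply: le_trans z1; rewrite ler_wpM2r //; lra.
by move: H1 H4; lra.
Qed.

End Weight.
End Graph.

(** * Leibniz rule, and moves of mass between two colours *)

Lemma deriv_prod (S : comNzRingType) (I : finType) (F : I -> {poly S}) :
  (\prod_i F i)^`() = \sum_i (F i)^`() * \prod_(j | j != i) F j.
Proof.
move: (index_enum I) (index_enum_uniq I) => r.
elim: r => [|x r IHr]; first by rewrite !big_nil derivC.
move=> /= /andP[xr /IHr IH]; rewrite !big_cons derivM IH eqxx /=; congr (_ * _ + _).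
  rewrite big_seq_cond [RHS]big_seq_cond; apply: eq_bigl => j.
  by case jr: (j \in r) => //=; apply/esym; apply: contraTneq jr => ->.
rewrite mulr_sumr; apply: eq_big_seq => i ir; rewrite big_cons.
by have -> : x != i; [apply: contraNneq xr => -> | rewrite mulrCA].
Qed.

Lemma exists_gt0_of_sum0 (R : realType) (I : finType) (f : I -> R) i :
  \sum_j f j = 0 -> f i != 0 -> exists j, 0 < f j.
Proof.
move=> f0 fi; apply/existsP; apply: contraR fi => /existsPn H.
have fN j : 0 <= - f j by rewrite oppr_ge0 leNgt.
rewrite -oppr_eq0; apply/eqP; apply: (psumr_eq0P (P := predT) (F := fun j => - f j)) => //.
by rewrite sumrN f0 oppr0.
Qed.

Section Transfer.
Variables (R : realType) (q : nat) (p : 'I_q -> R) (a b : 'I_q).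

Definition transfer (t : R) : 'I_q -> R :=
  fun c => p c + t * ((c == b)%:R - (c == a)%:R).

Definition transfer_poly : 'I_q -> {poly R} :=
  fun c => (p c)%:P + ((c == b)%:R - (c == a)%:R)%:P * 'X.

Lemma transferE t c : transfer t c = (transfer_poly c).[t].
Proof. by rewrite /transfer /transfer_poly !hornerE mulrC. Qed.

Lemma sum_transfer t : \sum_c transfer t c = \sum_c p c.
Proof.
rewrite big_split /= -mulr_sumr sumrB.
have sum_ind (d : 'I_q) : \sum_(c < q) (c == d)%:R = 1 :> R.
  by rewrite (bigD1 d) //= eqxx big1 ?addr0 // => c /negPf ->.
by rewrite !sum_ind subrr mulr0 addr0.
Qed.

Hypothesis ab : a != b.

Lemma transfer_a t : transfer t a = p a - t.
Proof. by rewrite /transfer eqxx (negPf ab) sub0r mulrN1. Qed.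

Lemma transfer_b t : transfer t b = p b + t.
Proof. by rewrite /transfer eqxx eq_sym (negPf ab) subr0 mulr1. Qed.

Lemma transfer_neq t c : c != a -> c != b -> transfer t c = p c.
Proof. by move=> /negPf ca /negPf cb; rewrite /transfer ca cb subrr mulr0 addr0. Qed.

End Transfer.

(** * Comparison of light and heavy laws with the uniform law *)

Section Comparison.
Variables (R : realType) (V : finType) (e : rel V) (q : nat).
Hypotheses (e_sym : symmetric e) (e_irr : irreflexive e).
Variable Dl : nat.
Hypothesis deg_le : forall u, (#|nbh e u| <= Dl)%N.
Implicit Types (p : 'I_q -> R) (a b c : 'I_q) (u v : V) (U : {set V}).

Notation P p := (pr p (proper_on e [set: V])).

(** By the Leibniz rule each vertex [v] contributes the colourings with [b] at [v] minus those with
    [a] at [v], both without the factor at [v]. *)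
Lemma deriv_transfer p a b t : \sum_c p c = 1 ->
  (pr (transfer_poly p a b) (proper_on e [set: V]))^`().[t]
  = - \sum_v bias e (transfer p a b t) a b ([set: V] :\ v) (nbh e v) set0.
Proof.
move=> p1; set pt := transfer p a b t.
have pt1 : \sum_c pt c = 1 by rewrite sum_transfer.
(* Properness with colour [c] at [v] says that the rest is proper and the neighbours of [v] avoid
   [c]; with [set0] as last argument, [d] imposes nothing. *)
have S v c d : \sum_(alpha : {ffun V -> 'I_q} | proper_on e [set: V] alpha && (alpha v == c))
    \prod_(u | u != v) pt (alpha u) = wt e pt c d ([set: V] :\ v) (nbh e v) set0.
  have fQ : free_at v (constrained e c d ([set: V] :\ v) (nbh e v) set0).
    by apply: free_constrained; rewrite !inE eqxx.
  rewrite /wt -(sum_color_at pt1 c fQ); apply: eq_bigl => alpha.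
  case: eqP => [av|]; rewrite ?andbF // !andbT.
  rewrite (proper_onD1 e_sym e_irr _ (in_setT v)) /constrained; congr (_ && _).
  rewrite setI0 [avoids d _ _](_ : _ = true) ?andbT; last first.
    by apply/avoidsP => u; rewrite inE.
  rewrite setIC av; apply/forall_inP/avoidsP => H u /H; by rewrite eq_sym.
rewrite /pr linear_sum horner_sum -sumrN /=.
under eq_bigr => alpha _ do rewrite deriv_prod horner_sum.
rewrite exchange_big /=; apply: eq_bigr => v _.
rewrite /bias opprB -(S v b a) -(S v a b) !big_mkcondr /= -sumrB; apply: eq_bigr => alpha _.
rewrite hornerM horner_prod; under eq_bigr => u _ do rewrite -transferE -/pt.
rewrite /transfer_poly derivD derivM !derivC derivX mul0r !add0r mulr1 hornerC.
by case: (alpha v == b); case: (alpha v == a); rewrite /=; ring.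
Qed.

Lemma le_transfer p a b t eta :
    (forall c, 0 <= p c) -> \sum_c p c = 1 -> (forall c, p c <= eta) ->
    (0 < Dl)%N -> 100 * Dl%:R * eta = 1 ->
    a != b -> 0 <= t -> p b + t <= p a - t ->
  P p <= P (transfer p a b t).
Proof.
move=> p0 p1 p_le Dl0 eta_Dl ab; rewrite le_eqVlt => /predU1P[<- _|t0 tab].
  by rewrite le_eqVlt; apply/orP; left; apply/eqP; apply: eq_bigr => alpha _;
    apply: eq_bigr => v _; rewrite /transfer mul0r addr0.
pose F := pr (transfer_poly p a b) (proper_on e [set: V]).
have FE s : F.[s] = P (transfer p a b s).
  rewrite /F /pr horner_sum; apply: eq_bigr => alpha _.
  by rewrite horner_prod; apply: eq_bigr => v _; rewrite transferE.
have -> : P p = F.[0].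
  rewrite FE; apply: eq_bigr => alpha _.
  by apply: eq_bigr => v _; rewrite /transfer mul0r addr0.
rewrite -FE -subr_ge0.
(* The gain is [t] times the derivative at some intermediate [s], where the law is still bounded by
   [eta] and [a] still has at least the mass of [b]. *)
have [s] := poly_mvt F t0; rewrite in_itv /= => /andP[s0 st] ->.
rewrite subr0 mulr_ge0 ?(ltW t0) // deriv_transfer // oppr_ge0.
apply: sumr_le0 => v _.
have q0 c : 0 <= transfer p a b s c.
  have [->|ca] := eqVneq c a; first by rewrite transfer_a //; have := p0 b; lra.
  have [->|cb] := eqVneq c b; first by rewrite transfer_b //; have := p0 b; lra.
  by rewrite transfer_neq.
have q_le c : transfer p a b s c <= eta.
  have [->|ca] := eqVneq c a; first by rewrite transfer_a //; have := p_le a; lra.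
  have [->|cb] := eqVneq c b; first by rewrite transfer_b //; have := p_le a; lra.
  by rewrite transfer_neq.
have q1 := etrans (sum_transfer p a b s) p1.
apply: (bias_le0 e_sym e_irr q0 q1 q_le deg_le Dl0 eta_Dl _ ab); rewrite ?sub0set //.
by rewrite transfer_a ?transfer_b //; lra.
Qed.

Hypothesis q_gt0 : (0 < q)%N.

Lemma sum_uniform : \sum_c uniform R q c = 1.
Proof.
by rewrite sumr_const card_ord -[LHS]mulr_natl divff // pnatr_eq0 -lt0n.
Qed.

(** Induction on the number of colours whose mass differs from 1/q. *)
Lemma light_le_uniform p eta :
    (forall c, 0 <= p c) -> \sum_c p c = 1 -> (forall c, p c <= eta) ->
    (0 < Dl)%N -> 100 * Dl%:R * eta = 1 ->
  P p <= P (uniform R q).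
Proof.
move=> + + + Dl0 eta_Dl; pose bad p := [set c | p c != q%:R^-1].
have [n] := ubnP #|bad p|; elim: n p => // n IHn p; rewrite ltnS => cn p0 p1 p_le.
have [bad0|[c]] := set_0Vmem (bad p).
  rewrite le_eqVlt; apply/orP; left; apply/eqP.
  apply: eq_bigr => alpha _; apply: eq_bigr => v _.
  by move/setP/(_ (alpha v)): bad0; rewrite !inE => /negbFE/eqP.
rewrite inE -subr_eq0 => pc.
(* The deviations from 1/q sum to zero and one is nonzero, so one colour lies above 1/q and another
   below. *)
have sum0 : \sum_c (p c - q%:R^-1) = 0.
  by rewrite sumrB p1 -[X in _ - X]/(\sum_c uniform R q c) sum_uniform subrr.
have [a a_gt] := exists_gt0_of_sum0 sum0 pc.
have [||b b_lt] := @exists_gt0_of_sum0 _ _ (fun c => - (p c - q%:R^-1)) c.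
- by rewrite sumrN sum0 oppr0.
- by rewrite oppr_eq0.
have ab : a != b by apply: contraTneq a_gt => ->; rewrite -leNgt; lra.
have pa_neq : p a != q%:R^-1 by rewrite gt_eqF; lra.
have pb_neq : p b != q%:R^-1 by rewrite lt_eqF; lra.
(* The largest move that overshoots 1/q at neither colour; it makes one of them exact and creates no
   new bad colour. *)
pose t := Num.min (p a - q%:R^-1) (q%:R^-1 - p b).
have ta : t <= p a - q%:R^-1 by rewrite ge_min lexx.
have tb : t <= q%:R^-1 - p b by rewrite ge_min lexx orbT.
have t0 : 0 <= t by rewrite le_min; apply/andP; split; lra.
apply: le_trans (le_transfer p0 p1 p_le Dl0 eta_Dl ab t0 _) _; first by lra.
have trE c' : transfer p a b t c' =
      if c' == a then p a - t else if c' == b then p b + t else p c'.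
  have [->|ca] := eqVneq c' a; first by rewrite transfer_a.
  have [->|cb] := eqVneq c' b; first by rewrite transfer_b.
  by rewrite transfer_neq.
apply: IHn; last 3 first.
- by move=> c'; rewrite trE; have := p0 c'; have := p0 b; do 2?[case: ifP => _]; lra.
- by rewrite sum_transfer.
- by move=> c'; rewrite trE; have := p_le c'; have := p_le a; do 2?[case: ifP => _]; lra.
apply: leq_trans cn; apply: proper_card; apply/properP; split.
  apply/subsetP => c'; rewrite !inE trE.
  have [->|_] := eqVneq c' a; first by rewrite pa_neq.
  by have [->|//] := eqVneq c' b; rewrite pb_neq.
have [h|h] := leP (p a - q%:R^-1) (q%:R^-1 - p b).
  exists a; rewrite !inE ?pa_neq //.
  by rewrite trE eqxx /t min_l // negbK; apply/eqP; ring.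
exists b; rewrite !inE ?pb_neq //.
by rewrite trE [b == a]eq_sym (negPf ab) eqxx /t min_r ?ltW // negbK; apply/eqP; ring.
Qed.

Lemma pr_edgeless p U : \sum_c p c = 1 ->
  (forall u v, u \in U -> v \in U -> ~~ e u v) -> pr p (proper_on e U) = 1.
Proof.
move=> p1 H; rewrite -(pr_predT V p1); apply: eq_pr => alpha.
by apply/proper_onP => u v uU vU euv; move: (H u v uU vU); rewrite euv.
Qed.

Lemma heavy_le_uniform p a U :
    (forall c, 0 <= p c) -> \sum_c p c = 1 -> (Dl < q)%N ->
    2 * Dl%:R * q%:R^-1 <= p a ^+ 2 ->
  pr p (proper_on e U) <= pr (uniform R q) (proper_on e U).
Proof.
move=> p0 p1 Dlq pa2; have [n] := ubnP #|U|; elim: n U => // n IHn U; rewrite ltnS => cU.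
have [/existsP[u /existsP[v /and3P[uU vU euv]]]|noedge] :=
  boolP [exists u, exists v, [&& u \in U, v \in U & e u v]]; last first.
  have H u v : u \in U -> v \in U -> ~~ e u v.
    move=> uU vU; apply: contraNN noedge => euv.
    by apply/existsP; exists u; apply/existsP; exists v; rewrite uU vU.
  by rewrite !pr_edgeless // sum_uniform.
have vu : v != u by apply: contraTneq euv => ->; rewrite e_irr.
have vU' : v \in U :\ u by rewrite !inE vu.
set W := (U :\ u) :\ v.
have uW : u \notin W by rewrite !inE eqxx andbF.
have vW : v \notin W by rewrite !inE eqxx.
have sWU : W \subset U by rewrite /W setDDl subsetDl.
have cW : (#|W| < n)%N.
  by move: cU; rewrite (cardsD1 u) uU (cardsD1 v) vU' -/W; lia.
have proper_sub U1 U2 alpha : U1 \subset U2 -> proper_on e U2 alpha -> proper_on e U1 alpha.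
  move=> /subsetP sU /proper_onP H; apply/proper_onP => x y /sU xU /sU yU; exact: H.
(* Given that [W] is properly coloured, [u] and [v] both receive [a] with probability [p a ^+ 2],
   and no such colouring is proper on [U]. *)
have upper : pr p (proper_on e U) <= (1 - p a ^+ 2) * pr p (proper_on e W).
  pose E (alpha : {ffun V -> 'I_q}) := (alpha v == a) && (alpha u == a).
  have fu : free_at u (fun alpha => proper_on e W alpha && (alpha v == a)).
    by move=> c alpha; rewrite (free_proper_on e uW) recolor_neq.
  have EE : pr p [pred alpha | proper_on e W alpha && E alpha]
      = p a ^+ 2 * pr p (proper_on e W).
    rewrite expr2 -mulrA -(pr_color_at p1 a (free_proper_on e vW)) -(pr_color_at p1 a fu).
    by apply: eq_pr => alpha; rewrite /= andbA.
  rewrite mulrBl mul1r -EE [X in X - _](pr_split p E) addrC addKr.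
  apply: le_pr => // alpha H /=; rewrite (proper_sub _ _ _ _ sWU H) /=.
  apply/negP => /andP[/eqP av /eqP au]; move/proper_onP/(_ u v uU vU euv): H.
  by rewrite av au eqxx.
have unif0 c : 0 <= uniform R q c by rewrite invr_ge0 ler0n.
have unifle c : uniform R q c <= q%:R^-1 by [].
(* Under the uniform law a restored vertex clashes with at most [Dl] neighbours, each with
   probability at most 1/q. *)
have ext x U' : x \in U' -> (1 - Dl%:R * q%:R^-1) * pr (uniform R q) (proper_on e (U' :\ x))
    <= pr (uniform R q) (proper_on e U').
  move=> xU'; have xN : x \notin nbh e x :&: (U' :\ x) by rewrite !inE e_irr.
  have fx : free_at x (proper_on (q := q) e (U' :\ x)).
    by apply: free_proper_on; rewrite !inE eqxx.
  apply: le_trans (le_trans (pr_extend unif0 sum_uniform unifle set0 fx xN) _).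
    apply: ler_wpM2r; first exact: pr_ge0.
    rewrite lerD2l lerN2 ler_wpM2r ?invr_ge0 ?ler0n // ler_nat cards0 addn0.
    by apply: leq_trans (deg_le x); apply: subset_leq_card; apply: subsetIl.
  apply: le_pr => // alpha /= /and3P[H _ H2].
  by rewrite (proper_onD1 e_sym e_irr _ xU') H H2.
have Dq1 : Dl%:R * q%:R^-1 <= 1 :> R.
  by rewrite ler_pdivrMr ?ltr0n // mul1r ler_nat ltnW.
have lower : (1 - Dl%:R * q%:R^-1) ^+ 2 * pr (uniform R q) (proper_on e W)
    <= pr (uniform R q) (proper_on e U).
  apply: le_trans (ext u U uU); rewrite expr2 -mulrA ler_wpM2l ?subr_ge0 //.
  exact: ext.
apply: le_trans upper (le_trans _ lower).
have IH := IHn W cW.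
have zp : 0 <= pr p (proper_on e W) by apply: pr_ge0.
have d0 : 0 <= Dl%:R * q%:R^-1 :> R by rewrite mulr_ge0 ?invr_ge0 ?ler0n.
(* With x = Dl/q, (1 - x)^2 >= 1 - 2x >= 1 - p_a^2. *)
apply: le_trans (_ : _ <= (1 - Dl%:R * q%:R^-1) ^+ 2 * pr p (proper_on e W)) _.
  by apply: ler_wpM2r => //; move: pa2 d0; rewrite -mulrA; nra.
by apply: ler_wpM2l => //; apply: sqr_ge0.
Qed.

End Comparison.

Theorem theorem1p1 (R : realType) (V : finType) (e : rel V)
    (He : simple_graph e) (q : nat) (q_gt0 : (0 < q)%N)
    (Hq : (4 * 10 ^ 4 * max_degree e ^ 4 < q)%N)
    (p : 'I_q -> R) (Hp : distribution p) :
  proper_prob e (uniform R q) >= proper_prob e p.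
Proof.
case: He => e_sym e_irr; case: Hp => p0 p1; set Dl := max_degree e in Hq.
have deg_le u : (#|nbh e u| <= Dl)%N by apply: (leq_bigmax u).
have PE (p' : 'I_q -> R) : proper_prob e p' = pr p' (proper_on e [set: V]).
  apply: eq_bigl => alpha; apply/forallP/proper_onP => [H u v _ _|H u].
    by move/forallP/(_ v)/implyP: (H u).
  by apply/forallP => v; apply/implyP; apply: H; rewrite inE.
rewrite !PE; case: (posnP Dl) => [D0|D_gt0].
  have noedge u v : u \in [set: V] -> v \in [set: V] -> ~~ e u v.
    move=> _ _; have := deg_le u; rewrite D0 leqn0 cards_eq0 => /eqP/setP/(_ v).
    by rewrite !inE => ->.
  by rewrite !pr_edgeless // sum_uniform.
have D1 : 1 <= Dl%:R :> R by rewrite ler1n.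
have eta_Dl : 100 * Dl%:R * (100 * Dl%:R)^-1 = 1 :> R by rewrite divff //; lra.
case: (boolP [exists a, (100 * Dl%:R)^-1 < p a]) => [/existsP[a pa]|/existsPn light].
  have Dlq : (Dl < q)%N.
    apply: leq_ltn_trans Hq; rewrite -{1}[Dl]mul1n -{1}(expn1 Dl).
    by apply: leq_mul => //; rewrite leq_pexp2l.
  apply: (heavy_le_uniform e_sym e_irr deg_le q_gt0 (a := a)) => //.
  (* As Dl >= 1, 20000 Dl^3 <= 40000 Dl^4 < q. This amounts to 2 Dl/q <= eta^2 < p_a^2 for the
     threshold eta = 1/(100 Dl). *)
  have Hq' : 2 * Dl%:R * (100 * Dl%:R) ^+ 2 <= q%:R :> R.
    have D34 : Dl%:R ^+ 3 <= Dl%:R ^+ 4 :> R by apply: ler_weXn2l.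
    have := Hq; rewrite -(ltr_nat R) natrM natrX (natrM _ 4) natrX.
    have -> : 2 * Dl%:R * (100 * Dl%:R) ^+ 2 = 20000 * Dl%:R ^+ 3 :> R by ring.
    have : 0 <= Dl%:R ^+ 4 :> R by apply: exprn_ge0.
    by move: D34; lra.
  have eta0 : 0 < (100 * Dl%:R)^-1 :> R by rewrite invr_gt0; lra.
  apply: le_trans (_ : (100 * Dl%:R)^-1 ^+ 2 <= _); last by rewrite ler_sqr ?nnegrE ?p0 // ltW.
  by rewrite exprVn ler_pdivrMr ?ltr0n // [leRHS]mulrC ler_pdivlMr // exprn_gt0 //; lra.
apply: (light_le_uniform e_sym e_irr deg_le q_gt0 p0 p1 _ D_gt0 eta_Dl) => c.
by rewrite leNgt.
Qed.
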